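(* For a finite set $P\subset[0,1]^2$ let $$D_P(x,y)=\#\bigl(P\cap([0,x]\times[0,y])\bigr)-\#(P)\cdot xy,\qquad (x,y)\in[0,1]^2,$$ and for every integer $N\ge 2$ let $$d_N=\frac{1}{\sqrt{\ln N}}\cdot\inf_{\substack{P\subset[0,1]^2\\ \#(P)=N}}\int_0^1\int_0^1|D_P(x,y)|\,dx\,dy .$$ Then $$\liminf_{N\to\infty}d_N\ \ge\ \frac{3}{256\sqrt{e\ln 2}}\qquad\text{and}\qquad \limsup_{N\to\infty}d_N\ \ge\ \frac{1}{64\sqrt{e\ln 2}} .$$
   Context: $\#(Q)$ denotes the cardinality of a finite set $Q$; $\ln$ is the natural logarithm and $e$ its base. $D_P$ is the two-dimensional (axis-parallel) discrepancy function of $P$. *)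

(* Defs.v *)
From HB Require Import structures.
From mathcomp Require Import all_boot all_order all_algebra.
From mathcomp Require Import finmap.
From mathcomp Require Import all_classical all_reals all_analysis.

Set Implicit Arguments.
Unset Strict Implicit.
Unset Printing Implicit Defensive.

Import Order.TTheory GRing.Theory Num.Theory.

Local Open Scope fset_scope.
Local Open Scope classical_set_scope.
Local Open Scope ring_scope.

Definition discrepancy (R : realType) (P : {fset R * R}) (x y : R) : R :=
  #|` [fset p in P | (p.1 \in `[0, x]) && (p.2 \in `[0, y])] |%:R
  - #|` P|%:R * (x * y).

Definition L1_discrepancy (R : realType) (P : {fset R * R}) : \bar R :=
  (\int[lebesgue_measure]_(x in `[0%R, 1%R])
     \int[lebesgue_measure]_(y in `[0%R, 1%R])
       `|discrepancy P x y|%:E)%E.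

(* The paper's d_N, for N >= 2.  The values at N = 0 and N = 1, where ln N is not
   positive, are junk that does not affect the limits inferior and superior. *)
Definition normalized_L1_discrepancy (R : realType) (N : nat) : \bar R :=
  (((Num.sqrt (ln N%:R))^-1)%:E *
   ereal_inf [set L1_discrepancy P | P in
     [set P : {fset R * R} |
        [set` P] `<=` `[0%R, 1%R] `*` `[0%R, 1%R] /\ #|` P| = N]])%E.

(* Main.v *)
Require Import Defs.
From HB Require Import structures.
From mathcomp Require Import all_boot all_order all_algebra.
From mathcomp Require Import finmap complex.
From mathcomp Require Import all_classical all_reals all_analysis.
From mathcomp Require Import measurable_realfun.
From mathcomp Require Import ring lra zify.

(** The proof is the Riesz product argument of Halasz for the L1 norm, in its
    complex form.

    Let N be the number of points of P, and choose n with t = N / 2^n <= 1/2.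
    For each k <= n, cut the unit square into the 2^n dyadic boxes of width
    2^-k and height 2^-(n-k), and let f_k be minus the sum of the Haar functions
    of those boxes that contain no point of P.  The counting part of D_P is
    orthogonal to the Haar function of a box without points, while - N x y has
    coefficient - N / (16 * 4^n) against each Haar function.  At least 2^n - N
    boxes are free, so <D_P, f_k> >= t (1 - t) / 16 for each of the n + 1
    shapes ([haar_layer_cellint]).

    Put m = n + 1 and test D_P against the imaginary part of the product of the
    1 + i f_k / sqrt m.  Its modulus is at most (1 + 1/m)^(m/2) <= sqrt e
    ([im_riesz_bound]); its linear part pairs with D_P to at least
    sqrt m * t (1 - t) / 16.  The remaining terms are grouped by their smallest
    index l and largest index k: the group is - f_l f_k / m times the imaginary
    part of the partial product over l < j < k ([im_riesz_head_tail]), which is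
    bounded by sqrt e again.  On boxes of width 2^-k and height 2^-(n-l) such a
    group is a constant times a Haar function, and it vanishes on boxes that
    contain a point; hence its pairing with D_P is at most
    sqrt e * t * 2^-(k-l) / (16 m) ([haar_layer_pair_cellint]).  The sum over
    l < k is bounded uniformly in n, so that
      int |D_P| >= sqrt m * t (1 - t) / (16 sqrt e) - t / 16
    ([L1_discrepancy_ge]).

    Since m ln 2 >= ln N, dividing by sqrt (ln N) gives
      d_N >= t (1 - t) / (16 sqrt (e ln 2)) - o(1).
    Some n always has t in [1/4, 1/2], where t (1 - t) >= 3/16: this is the
    lower limit.  When N is a power of 2 one may take t = 1/2: this is the upper
    limit.

    Every f_k is constant on the cells of the grid of step 2^-(n+1), so only the
    integrals of D_P over these cells matter ([cellint]), and all the Haar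
    analysis is about finite sums of them.  A Haar coefficient is then a second
    difference of an antiderivative ([sum_rademacher_block]). *)

Set Implicit Arguments.
Unset Strict Implicit.
Unset Printing Implicit Defensive.

Import Order.TTheory GRing.Theory Num.Theory.

Local Open Scope ring_scope.

(** * Riesz products *)
Lemma prod1D_head (A : comNzRingType) (w : nat -> A) k :
  \prod_(0 <= j < k) (1 + w j) =
  1 + \sum_(0 <= l < k) w l * \prod_(l.+1 <= j < k) (1 + w j).
Proof.
elim: k => [|k IH]; first by rewrite big_geq // big_geq // addr0.
rewrite [in LHS]big_nat_recr //= IH [in RHS](@big_nat_recr _ _ _ k) //=.
rewrite (@big_geq _ _ _ k.+1 k.+1) // mulr1.
rewrite mulrDl mul1r -!addrA; congr (_ + _); rewrite addrC mulr_suml; congr (_ + _).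
by apply: eq_big_nat => l /andP[_ lk]; rewrite (@big_nat_recr _ _ _ k) //= mulrA.
Qed.

(** Expanding the product only at its smallest and largest factors leaves the
    inner factors as an unexpanded product, to which the bound on the modulus
    can be applied again. *)
Lemma prod1D_head_tail (A : comNzRingType) (w : nat -> A) m :
  \prod_(0 <= j < m) (1 + w j) =
  1 + \sum_(0 <= k < m) w k +
  \sum_(0 <= k < m) \sum_(0 <= l < k) w l * w k * \prod_(l.+1 <= j < k) (1 + w j).
Proof.
elim: m => [|m IH]; first by rewrite big_geq // !big_geq // !addr0.
rewrite [in LHS]big_nat_recr //= [X in _ = 1 + X + _]big_nat_recr //=.
rewrite [X in _ = _ + X]big_nat_recr //= mulrDr mulr1.
rewrite {2}prod1D_head mulrDl mul1r mulr_suml IH.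
have -> : \sum_(0 <= l < m) w l * w m * \prod_(l.+1 <= j < m) (1 + w j) =
  \sum_(0 <= l < m) w l * \prod_(l.+1 <= j < m) (1 + w j) * w m.
  by apply: eq_bigr => l _; rewrite mulrAC.
ring.
Qed.

Definition im_riesz (R : rcfType) (eps : R) (f : nat -> R) (l k : nat) : R :=
  complex.Im (\prod_(l <= j < k) (1 + Complex 0 (eps * f j))).

Lemma Im_sum (R : rcfType) (I : Type) (s : seq I) (F : I -> R[i]) :
  complex.Im (\sum_(i <- s) F i) = \sum_(i <- s) complex.Im (F i).
Proof. by apply: (big_morph (@complex.Im R)) => // -[a b] [c d]. Qed.

Lemma im_riesz_head_tail (R : rcfType) (eps : R) (f : nat -> R) m :
  im_riesz eps f 0 m = eps * \sum_(0 <= k < m) f k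
   - eps ^+ 2 * \sum_(0 <= k < m) \sum_(0 <= l < k) f l * f k * im_riesz eps f l.+1 k.
Proof.
rewrite /im_riesz prod1D_head_tail.
have ImD (x y : R[i]) : complex.Im (x + y) = complex.Im x + complex.Im y.
  by case: x y => [a b] [c d].
rewrite !ImD /= add0r !Im_sum mulr_sumr -mulrN -sumrN mulr_sumr; congr (_ + _).
apply: eq_bigr => k _; rewrite Im_sum -sumrN mulr_sumr.
apply: eq_bigr => l _.
case: (\prod_(_ <= j < k) _) => x y /=; ring.
Qed.

(** Each factor has squared modulus at most 1 + 1/m <= exp (1/m), and there are
    at most m of them. *)
Lemma im_riesz_bound (R : realType) (f : nat -> R) (m l k : nat) :
  (0 < m)%N -> (k - l <= m)%N -> (forall j, `|f j| <= 1) ->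
  `|im_riesz (Num.sqrt m%:R)^-1 f l k| <= Num.sqrt (expR 1).
Proof.
move=> m0 klm f1; set eps := (Num.sqrt _)^-1.
have eps2 : eps ^+ 2 = m%:R^-1 by rewrite /eps exprVn sqr_sqrtr // ler0n.
pose z := \prod_(l <= j < k) (1 + Complex 0 (eps * f j)).
pose nrm (w : R[i]) := complex.Re w ^+ 2 + complex.Im w ^+ 2.
have nrmM : {morph nrm : x y / x * y >-> x * y}.
  by move=> [a b] [c d]; rewrite /nrm /=; ring.
have zE : nrm z = \prod_(l <= j < k) (1 + (eps * f j) ^+ 2).
  rewrite /z (big_morph nrm nrmM (_ : _ = 1)) /nrm; last by rewrite /=; ring.
  by apply: eq_bigr => j _ /=; ring.
have zle : nrm z <= expR 1.
  rewrite zE; apply: (@le_trans _ _ (\prod_(l <= j < k) expR m%:R^-1)).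
    apply: ler_prod => j _; apply/andP; split.
      by rewrite addr_ge0 // sqr_ge0.
    apply: le_trans (expR_ge1Dx _); rewrite lerD2l exprMn eps2.
    rewrite ler_piMr ?invr_ge0 ?ler0n // -real_normK ?num_real //.
    by rewrite expr_le1 // f1.
  rewrite prodr_const_nat -expRM_natl ler_expR.
  by rewrite ler_pdivrMr ?ltr0n // mul1r ler_nat.
rewrite -sqrtr_sqr ler_sqrt ?expR_ge0 //; apply: le_trans zle.
by rewrite /nrm lerDr sqr_ge0.
Qed.

Lemma eq_im_riesz (R : rcfType) (eps : R) (f g : nat -> R) (l k : nat) :
  (forall j, (l <= j < k)%N -> f j = g j) -> im_riesz eps f l k = im_riesz eps g l k.
Proof. by move=> fg; congr complex.Im; apply: eq_big_nat => j /fg ->. Qed.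

(** * Haar coefficients as second differences *)
Definition rademacher (R : realType) (a i : nat) : R := (-1) ^+ (i %/ 2 ^ a).

(** On a dyadic block of length 2^(a+1) the sign is + on the left half and - on
    the right half (I.*2 is even, I.*2.+1 is odd); each half telescopes. *)
Lemma sum_rademacher_block (R : realType) (a I : nat) (W : nat -> R) :
  \sum_(I * 2 ^ a.+1 <= i < I.+1 * 2 ^ a.+1) rademacher R a i * (W i.+1 - W i) =
  2 * W (I * 2 ^ a.+1 + 2 ^ a)%N - W (I * 2 ^ a.+1)%N - W (I.+1 * 2 ^ a.+1)%N.
Proof.
have p0 : (0 < 2 ^ a)%N by rewrite expn_gt0.
have pS : (2 ^ a.+1 = 2 ^ a + 2 ^ a)%N by rewrite expnS; lia.
have half (s : nat) : \sum_(s * 2 ^ a <= i < s.+1 * 2 ^ a) rademacher R a i * (W i.+1 - W i) =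
    (-1) ^+ s * (W (s.+1 * 2 ^ a)%N - W (s * 2 ^ a)%N).
  rewrite -telescope_sumr ?leq_mul2r ?leqnSn ?orbT // mulr_sumr.
  apply: eq_big_nat => i /andP[li ui]; rewrite /rademacher; congr (_ ^+ _ * _).
  by apply/eqP; rewrite eqn_leq leq_divRL // li andbT -ltnS ltn_divLR.
have -> : (I * 2 ^ a.+1 = I.*2 * 2 ^ a)%N by rewrite pS; lia.
have -> : (I.+1 * 2 ^ a.+1 = I.*2.+2 * 2 ^ a)%N by rewrite pS; lia.
have -> : (I.*2 * 2 ^ a + 2 ^ a = I.*2.+1 * 2 ^ a)%N by lia.
rewrite (@big_cat_nat _ _ _ (I.*2.+1 * 2 ^ a)%N) /= ?leq_mul2r ?leqnSn ?orbT //.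
rewrite !half exprS -signr_odd odd_double expr0; ring.
Qed.

Definition grid (R : realType) (K i : nat) : R := i%:R / 2 ^+ K.
(** An antiderivative of the indicator of [p, +oo[. *)
Definition hinge (R : realType) (p t : R) : R := Num.max (t - p) 0.
(** The index of the half-open grid interval that contains x; for x = 1 it is
    2^K, so that a point on the upper or right side of the square is in no
    block. *)
Definition cell (R : realType) (K : nat) (x : R) : nat := Num.truncn (x * 2 ^+ K).

Lemma grid_nat_pow (R : realType) (K i a : nat) : (a <= K)%N ->
  grid R K (i * 2 ^ a) = grid R (K - a) i.
Proof.
move=> aK; rewrite /grid natrM natrX -{1}(subnK aK) exprD.
by field; rewrite !expf_neq0.
Qed.

(** The hinge at x is affine on a block unless x is interior to it, and the
    second difference of an affine function is 0. *)
Lemma sum_rademacher_hinge (R : realType) (K a I : nat) (x : R) :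
  0 <= x -> (cell K x %/ 2 ^ a.+1)%N != I ->
  \sum_(I * 2 ^ a.+1 <= i < I.+1 * 2 ^ a.+1)
     rademacher R a i * (hinge x (grid R K i.+1) - hinge x (grid R K i)) = 0.
Proof.
move=> x0 xI; rewrite (sum_rademacher_block a I (fun i => hinge x (grid R K i))).
have p0 : (0 < 2 ^ a)%N by rewrite expn_gt0.
have pS : (2 ^ a.+1 = 2 ^ a + 2 ^ a)%N by rewrite expnS; lia.
have q0 : 0 < 2 ^+ K :> R by rewrite exprn_gt0.
have /andP[cl cu] : (cell K x)%:R <= x * 2 ^+ K < (cell K x).+1%:R.
  by apply: truncn_itv; rewrite mulr_ge0 // ltW.
have hl i : (cell K x < i)%N -> hinge x (grid R K i) = grid R K i - x.
  move=> ci; rewrite /hinge max_l // subr_ge0 /grid ler_pdivlMr //.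
  by apply: le_trans (ltW cu) _; rewrite ler_nat.
have hr i : (i <= cell K x)%N -> hinge x (grid R K i) = 0.
  move=> ci; rewrite /hinge max_r // subr_le0 /grid ler_pdivrMr //.
  by apply: le_trans _ cl; rewrite ler_nat.
have := divn_eq (cell K x) (2 ^ a.+1).
have := ltn_pmod (cell K x) (_ : 0 < 2 ^ a.+1)%N.
rewrite expn_gt0 => /(_ isT).
move: xI; set q := (_ %/ _)%N; set r := (_ %% _)%N => xI rlt ceq.
case: (ltngtP q I) xI => // qI _.
  (* x is to the left of the block, where the hinge is t - x *)
  have qb : (cell K x < I * 2 ^ a.+1)%N.
    apply: (@leq_trans (q.+1 * 2 ^ a.+1)); last by rewrite leq_mul2r qI orbT.
    by rewrite ceq mulSn; lia.
  have Ib : (I * 2 ^ a.+1 <= I.+1 * 2 ^ a.+1)%N by rewrite leq_mul2r leqnSn orbT.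
  rewrite !hl; [|lia..].
  rewrite /grid mulSn pS !natrD !natrM !natrD; field; exact: lt0r_neq0.
(* x is to the right of the block, where the hinge is 0 *)
have qb : (I.+1 * 2 ^ a.+1 <= cell K x)%N.
  apply: (@leq_trans (q * 2 ^ a.+1)); first by rewrite leq_mul2r qI orbT.
  by rewrite ceq leq_addr.
have Ib : (I.+1 * 2 ^ a.+1 = I * 2 ^ a.+1 + 2 ^ a + 2 ^ a)%N by rewrite mulSn pS; lia.
rewrite !hr; [ring|lia..].
Qed.

Lemma sum_rademacher_sqr (R : realType) (K a I : nat) : (a < K)%N ->
  \sum_(I * 2 ^ a.+1 <= i < I.+1 * 2 ^ a.+1)
     rademacher R a i * ((grid R K i.+1) ^+ 2 / 2 - (grid R K i) ^+ 2 / 2) =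
  - (4 * (2 ^+ (K - a.+1)) ^+ 2)^-1.
Proof.
move=> aK; rewrite (sum_rademacher_block a I (fun i => (grid R K i) ^+ 2 / 2)).
rewrite !grid_nat_pow //.
have -> : grid R K (I * 2 ^ a.+1 + 2 ^ a) = grid R (K - a.+1) I + (2 ^+ (K - a.+1) * 2)^-1.
  move: (K - a.+1)%N (subnK aK) => e <-.
  by rewrite /grid natrD natrM !natrX exprD exprS; field; rewrite !expf_neq0.
rewrite /grid -[I.+1]addn1 natrD; field; exact: expf_neq0.
Qed.

(** The integral of the discrepancy function of P over the grid cell (i, j),
    in terms of antiderivatives; [abs_cellint_le] makes the link. *)
Definition cellint (R : realType) (K : nat) (P : seq (R * R)) (i j : nat) : R :=
  \sum_(p <- P) (hinge p.1 (grid R K i.+1) - hinge p.1 (grid R K i))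
                * (hinge p.2 (grid R K j.+1) - hinge p.2 (grid R K j))
  - (size P)%:R * ((grid R K i.+1 ^+ 2 / 2 - grid R K i ^+ 2 / 2)
                   * (grid R K j.+1 ^+ 2 / 2 - grid R K j ^+ 2 / 2)).

(** The exponent is shifted because blocks carry a Haar function: a block of
    length 2^(a+1) has halves of length 2^a. *)
Definition same_block (a i i' : nat) := (i %/ 2 ^ a.+1 == i' %/ 2 ^ a.+1)%N.

(** G plays the coefficients of a combination of Haar functions of boxes of one
    shape.  Where a box contains a point, G vanishes; in the other boxes each
    point misses the box in one of the two coordinates, so that its product term
    is killed by [sum_rademacher_hinge].  Only - N x y remains. *)
Lemma sum_rademacher_cellint (R : realType) (K a b : nat) (P : seq (R * R))
    (G : nat -> nat -> R) :
  (a < K)%N -> (b < K)%N -> (forall p, p \in P -> 0 <= p.1 /\ 0 <= p.2) ->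
  (forall i i' j j', same_block a i i' -> same_block b j j' -> G i j = G i' j') ->
  (forall p i j, p \in P -> same_block a (cell K p.1) i ->
     same_block b (cell K p.2) j -> G i j = 0) ->
  \sum_(0 <= i < 2 ^ K) \sum_(0 <= j < 2 ^ K)
     G i j * rademacher R a i * rademacher R b j * cellint K P i j =
  - ((size P)%:R / (16 * (2 ^+ (K - a.+1) * 2 ^+ (K - b.+1)) ^+ 2)) *
  \sum_(0 <= I < 2 ^ (K - a.+1)) \sum_(0 <= J < 2 ^ (K - b.+1))
     G (I * 2 ^ a.+1)%N (J * 2 ^ b.+1)%N.
Proof.
move=> aK bK P0 Gcst Gvan.
have E c : (c < K)%N -> (2 ^ K = 2 ^ (K - c.+1) * 2 ^ c.+1)%N.
  by move=> cK; rewrite -expnD subnK.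
rewrite {1}(E _ aK) big_nat_mul mulr_sumr; apply: eq_big_nat => I _.
under eq_bigr do rewrite (E _ bK) big_nat_mul.
rewrite exchange_big mulr_sumr; apply: eq_big_nat => J _.
have blockE c I' i : (I' * 2 ^ c.+1 <= i < I'.+1 * 2 ^ c.+1)%N -> (i %/ 2 ^ c.+1 = I')%N.
  have p0 : (0 < 2 ^ c.+1)%N by rewrite expn_gt0.
  move=> /andP[l u]; apply/eqP.
  by rewrite eqn_leq leq_divRL // l andbT -ltnS ltn_divLR.
have bE c I' : (I' * 2 ^ c.+1 %/ 2 ^ c.+1 = I')%N by rewrite mulnK // expn_gt0.
transitivity (\sum_(I * 2 ^ a.+1 <= i < I.+1 * 2 ^ a.+1)
   \sum_(J * 2 ^ b.+1 <= j < J.+1 * 2 ^ b.+1)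
    G (I * 2 ^ a.+1)%N (J * 2 ^ b.+1)%N * (rademacher R a i * rademacher R b j * cellint K P i j)).
  apply: eq_big_nat => i iI; apply: eq_big_nat => j jJ.
  rewrite -!mulrA; congr (_ * _).
  by apply: Gcst; rewrite /same_block bE (blockE _ _ _ iI, blockE _ _ _ jJ).
under eq_bigr do rewrite -mulr_sumr.
rewrite -mulr_sumr [RHS]mulrC.
have [->|G0] := eqVneq (G (I * 2 ^ a.+1)%N (J * 2 ^ b.+1)%N) 0; first by rewrite !mul0r.
congr (_ * _).
pose u i (p : R * R) := rademacher R a i * (hinge p.1 (grid R K i.+1) - hinge p.1 (grid R K i)).
pose v j (p : R * R) := rademacher R b j * (hinge p.2 (grid R K j.+1) - hinge p.2 (grid R K j)).
pose s c i := rademacher R c i * (grid R K i.+1 ^+ 2 / 2 - grid R K i ^+ 2 / 2).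
transitivity (\sum_(I * 2 ^ a.+1 <= i < I.+1 * 2 ^ a.+1)
   \sum_(J * 2 ^ b.+1 <= j < J.+1 * 2 ^ b.+1)
   (\sum_(p <- P) u i p * v j p - (size P)%:R * (s a i * s b j))).
  apply: eq_bigr => i _; apply: eq_bigr => j _.
  rewrite /cellint mulrBr mulr_sumr; congr (_ - _); last by rewrite /s; ring.
  by apply: eq_bigr => p _; rewrite /u /v; ring.
under eq_bigr do rewrite sumrB.
rewrite sumrB.
have -> : \sum_(I * 2 ^ a.+1 <= i < I.+1 * 2 ^ a.+1)
   \sum_(J * 2 ^ b.+1 <= j < J.+1 * 2 ^ b.+1) \sum_(p <- P) u i p * v j p = 0.
  under eq_bigr do rewrite exchange_big.
  rewrite exchange_big /= big1_seq // => p /andP[_ pP].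
  under eq_bigr do rewrite -mulr_sumr.
  rewrite -mulr_suml.
  have [p1 p2] := P0 _ pP.
  have [e1|n1] := eqVneq (cell K p.1 %/ 2 ^ a.+1)%N I; last first.
    by rewrite sum_rademacher_hinge // mul0r.
  have [e2|n2] := eqVneq (cell K p.2 %/ 2 ^ b.+1)%N J; last first.
    by rewrite [X in _ * X]sum_rademacher_hinge // mulr0.
  by case/eqP: G0; apply: (Gvan p) => //; rewrite /same_block bE ?e1 ?e2.
under eq_bigr do rewrite -mulr_sumr -mulr_sumr.
rewrite -mulr_sumr -mulr_suml /s !sum_rademacher_sqr // sub0r.
by field; rewrite !expf_neq0.
Qed.

(** * Haar functions of boxes without points *)
Definition box_free (R : realType) (n : nat) (P : seq (R * R)) (k i j : nat) : bool :=
  all (fun p => ~~ (same_block (n - k) (cell n.+1 p.1) i &&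
                    same_block k (cell n.+1 p.2) j)) P.

(** The function f_k of the opening comment on the cell (i, j).  The sign makes its
    pairing with - N x y positive. *)
Definition haar_layer (R : realType) (n : nat) (P : seq (R * R)) (i j k : nat) : R :=
  - (box_free n P k i j)%:R * rademacher R (n - k) i * rademacher R k j.

(** Dyadic blocks are nested. *)
Lemma eq_divn_pow2 (c d i i' : nat) : (c <= d)%N ->
  (i %/ 2 ^ c = i' %/ 2 ^ c)%N -> (i %/ 2 ^ d = i' %/ 2 ^ d)%N.
Proof. by move=> cd e; rewrite -(subnKC cd) expnD !divnMA e. Qed.

Lemma normr_rademacher (R : realType) (a i : nat) : `|rademacher R a i| = 1.
Proof. by rewrite normrX normrN1 expr1n. Qed.

Lemma eq_box_free (R : realType) n (P : seq (R * R)) a b k i i' j j' :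
  (a <= n - k)%N -> (b <= k)%N ->
  same_block a i i' -> same_block b j j' -> box_free n P k i j = box_free n P k i' j'.
Proof.
move=> ak bk /eqP ii' /eqP jj'; apply: eq_all => p.
rewrite /same_block (eq_divn_pow2 _ ii') // (eq_divn_pow2 _ jj') //.
Qed.

Lemma eq_rademacher (R : realType) a c i i' : (a < c)%N -> same_block a i i' ->
  rademacher R c i = rademacher R c i'.
Proof. by move=> ac /eqP ii'; rewrite /rademacher (eq_divn_pow2 ac ii'). Qed.

Lemma sum_eqn_le1 (R : realType) (c m : nat) : \sum_(0 <= I < m) (c == I)%:R <= 1 :> R.
Proof.
elim: m => [|m IH]; first by rewrite big_geq.
rewrite big_nat_recr //=; have [->|] := eqVneq c m; last by rewrite addr0.
rewrite big1_seq ?add0r // => I; rewrite mem_index_iota => /andP[_ /andP[_ Im]].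
by rewrite gtn_eqF.
Qed.

(** Each point spoils at most one of the 2^n boxes of a given shape. *)
Lemma count_box_free (R : realType) n (P : seq (R * R)) k : (k <= n)%N ->
  2 ^+ n - (size P)%:R <=
  \sum_(0 <= I < 2 ^ k) \sum_(0 <= J < 2 ^ (n - k))
     (box_free n P k (I * 2 ^ (n - k).+1) (J * 2 ^ k.+1))%:R :> R.
Proof.
move=> kn.
have bE c I' : (I' * 2 ^ c.+1 %/ 2 ^ c.+1 = I')%N by rewrite mulnK // expn_gt0.
pose hit (p : R * R) I J : R := (cell n.+1 p.1 %/ 2 ^ (n - k).+1 == I)%N%:R *
   (cell n.+1 p.2 %/ 2 ^ k.+1 == J)%N%:R.
have free I J : 1 - \sum_(p <- P) hit p I J <=
    (box_free n P k (I * 2 ^ (n - k).+1) (J * 2 ^ k.+1))%:R.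
  rewrite /box_free; elim: P => [|p P IH] /=; first by rewrite big_nil subr0.
  have h0 : 0 <= \sum_(q <- P) hit q I J.
    by apply: sumr_ge0 => q _; rewrite mulr_ge0 // ler0n.
  rewrite big_cons {1 2}/same_block !bE.
  move: IH h0; set S := \sum_(q <- P) _; set b := all _ P.
  by rewrite /hit; case: (_ == I); case: (_ == J) => /=; rewrite ?mulr1 ?mulr0; lra.
apply: (@le_trans _ _ (\sum_(0 <= I < 2 ^ k) \sum_(0 <= J < 2 ^ (n - k))
    (1 - \sum_(p <- P) hit p I J))); last by apply: ler_sum => I _; apply: ler_sum.
under eq_bigr do rewrite sumrB.
rewrite sumrB; apply: lerB.
  under eq_bigr do rewrite sumr_const_nat subn0.
  by rewrite sumr_const_nat subn0 -mulrnA -expnD subnK // natrX.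
under eq_bigr do rewrite exchange_big.
rewrite exchange_big /= -sum1_size natr_sum; apply: ler_sum => p _.
under eq_bigr do rewrite -mulr_sumr.
rewrite -mulr_suml mulr_ile1 ?sum_eqn_le1 // ?sumr_ge0 // => *; exact: ler0n.
Qed.

Lemma haar_layer_cellint (R : realType) n (P : seq (R * R)) k : (k <= n)%N ->
  (forall p, p \in P -> 0 <= p.1 /\ 0 <= p.2) ->
  (size P)%:R * (2 ^+ n - (size P)%:R) / (16 * (2 ^+ n) ^+ 2) <=
  \sum_(0 <= i < 2 ^ n.+1) \sum_(0 <= j < 2 ^ n.+1)
     haar_layer n P i j k * cellint n.+1 P i j.
Proof.
move=> kn P0.
rewrite (@sum_rademacher_cellint _ n.+1 (n - k) k P (fun i j => - (box_free n P k i j)%:R)) //.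
- rewrite !subSS subKn // -exprD subnKC //.
  under eq_bigr do rewrite sumrN.
  rewrite sumrN mulrNN [leLHS]mulrAC; apply: ler_wpM2l; last exact: count_box_free.
  by rewrite mulr_ge0 ?invr_ge0 ?mulr_ge0 ?exprn_ge0 ?ler0n.
- by rewrite ltnS leq_subr.
- by move=> i i' j j' ii' jj'; rewrite (@eq_box_free _ n P (n - k) k k i i' j j').
- move=> p i j pP bi bj; rewrite /box_free.
  by case: allP => [/(_ _ pP)|_]; rewrite ?bi ?bj ?oppr0.
Qed.

(** The finest width, 2^-k, comes from f_k and the finest height, 2^-(n-l), from
    f_l.  All other factors, including the inner Riesz product, are constant on
    boxes of that width and height, and such a box is contained in a box of the
    k-th shape, which is why a point in it makes f_k vanish. *)
Lemma haar_layer_pair_cellint (R : realType) n (P : seq (R * R)) (eps c : R) l k :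
  (l < k <= n)%N -> (forall p, p \in P -> 0 <= p.1 /\ 0 <= p.2) ->
  (forall i j, `|im_riesz eps (haar_layer n P i j) l.+1 k| <= c) ->
  `| \sum_(0 <= i < 2 ^ n.+1) \sum_(0 <= j < 2 ^ n.+1)
     haar_layer n P i j l * haar_layer n P i j k *
     im_riesz eps (haar_layer n P i j) l.+1 k * cellint n.+1 P i j |
  <= (size P)%:R * c / (16 * 2 ^+ n) * (2 ^+ l / 2 ^+ k).
Proof.
move=> /andP[lk kn] P0 rc.
pose G i j : R := (box_free n P l i j)%:R * (box_free n P k i j)%:R *
  rademacher R (n - l) i * rademacher R k j * im_riesz eps (haar_layer n P i j) l.+1 k.
rewrite [X in `|X|](_ : _ = \sum_(0 <= i < 2 ^ n.+1) \sum_(0 <= j < 2 ^ n.+1)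
    G i j * rademacher R (n - k) i * rademacher R l j * cellint n.+1 P i j); last first.
  by apply: eq_bigr => i _; apply: eq_bigr => j _; rewrite /G /haar_layer; ring.
rewrite (@sum_rademacher_cellint _ n.+1 (n - k) l P G) //; last 4 first.
- by rewrite ltnS leq_subr.
- by rewrite ltnS (leq_trans (ltnW lk)).
- move=> i i' j j' ii' jj'; rewrite /G.
  have bf h : (l <= h <= k)%N -> box_free n P h i j = box_free n P h i' j'.
    by move=> /andP[lh hk]; apply: eq_box_free ii' jj'; lia.
  rewrite !bf ?leqnn ?(ltnW lk) // (eq_rademacher _ _ ii') ?(eq_rademacher _ _ jj') //; last by lia.
  congr (_ * _); apply: eq_im_riesz => h /andP[lh hk]; rewrite /haar_layer.
  by rewrite bf ?(eq_rademacher _ _ ii') ?(eq_rademacher _ _ jj') //; lia.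
- move=> p i j pP bi bj; rewrite /G.
  suff -> : box_free n P k i j = false by rewrite mulr0 !mul0r.
  rewrite /box_free; case: allP => // /(_ _ pP); rewrite bi /=.
  by move/eqP: bj => /(@eq_divn_pow2 _ k.+1) -/(_ (ltnW lk)) e; rewrite /same_block e eqxx.
rewrite !subSS subKn //.
set S := \sum_(_ <= _ < _) _.
have SE : `|S| <= 2 ^+ k * 2 ^+ (n - l) * c.
  rewrite -mulrA; apply: le_trans (ler_norm_sum _ _ _) _.
  apply: (@le_trans _ _ (\sum_(0 <= I < 2 ^ k) (2 ^+ (n - l) * c))); last first.
    by rewrite sumr_const_nat subn0 -[leLHS]mulr_natl natrX.
  apply: ler_sum => I _; apply: le_trans (ler_norm_sum _ _ _) _.
  apply: (@le_trans _ _ (\sum_(0 <= J < 2 ^ (n - l)) c)); last first.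
    by rewrite sumr_const_nat subn0 -[leLHS]mulr_natl natrX.
  apply: ler_sum => J _; rewrite /G normrM; apply: le_trans (rc _ _).
  rewrite -[leRHS]mul1r; apply: ler_wpM2r => //.
  rewrite !normrM !normr_rademacher !mulr1 !normr_nat.
  by case: box_free; case: box_free; rewrite ?mulr0 ?mul0r ?mul1r.
have ln : (l <= n)%N by rewrite (leq_trans (ltnW lk)).
have x0 : 0 < 2 ^+ k :> R by rewrite exprn_gt0.
have y0 : 0 < 2 ^+ (n - l) :> R by rewrite exprn_gt0.
have z0 : 0 < 2 ^+ l :> R by rewrite exprn_gt0.
rewrite normrM normrN [X in X * _]ger0_norm; last first.
  by rewrite mulr_ge0 ?ler0n // invr_ge0 mulr_ge0 // ?exprn_ge0 // ?mulr_ge0 ?ltW.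
apply: (@le_trans _ _ ((size P)%:R / (16 * (2 ^+ k * 2 ^+ (n - l)) ^+ 2) *
   (2 ^+ k * 2 ^+ (n - l) * c))).
  apply: ler_wpM2l SE.
  by rewrite mulr_ge0 ?ler0n // invr_ge0 mulr_ge0 // ?exprn_ge0 // ?mulr_ge0 ?ltW.
have -> : 2 ^+ n = 2 ^+ l * 2 ^+ (n - l) :> R by rewrite -exprD subnKC.
rewrite le_eqVlt; apply/orP; left; apply/eqP.
by field; rewrite !lt0r_neq0.
Qed.

(** The pairing of the Riesz product with the discrepancy: the first term is the
    linear part, the second bounds all the others, through
    sum_(l < k) 2^-(k-l) <= 1 for each of the n + 1 values of k. *)
Lemma im_riesz_cellint (R : realType) n (P : seq (R * R)) :
  (forall p, p \in P -> 0 <= p.1 /\ 0 <= p.2) ->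
  Num.sqrt n.+1%:R * ((size P)%:R * (2 ^+ n - (size P)%:R) / (16 * (2 ^+ n) ^+ 2))
    - (size P)%:R * Num.sqrt (expR 1) / (16 * 2 ^+ n) <=
  \sum_(0 <= i < 2 ^ n.+1) \sum_(0 <= j < 2 ^ n.+1)
     im_riesz (Num.sqrt n.+1%:R)^-1 (haar_layer n P i j) 0 n.+1 * cellint n.+1 P i j.
Proof.
move=> P0; set eps := (Num.sqrt _)^-1.
have eps0 : 0 < eps by rewrite invr_gt0 sqrtr_gt0 ltr0n.
have eps2 : eps ^+ 2 = n.+1%:R^-1 by rewrite /eps exprVn sqr_sqrtr // ler0n.
have epsn : eps * n.+1%:R = Num.sqrt n.+1%:R.
  by rewrite -[X in _ * X]sqr_sqrtr ?ler0n // -[Num.sqrt _]invrK -/eps; field; rewrite gt_eqF.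
set c := _ / (16 * (2 ^+ n) ^+ 2); set d := _ / (16 * 2 ^+ n).
pose T1 k := \sum_(0 <= i < 2 ^ n.+1) \sum_(0 <= j < 2 ^ n.+1)
     haar_layer n P i j k * cellint n.+1 P i j.
pose T2 k l := \sum_(0 <= i < 2 ^ n.+1) \sum_(0 <= j < 2 ^ n.+1)
     haar_layer n P i j l * haar_layer n P i j k *
     im_riesz eps (haar_layer n P i j) l.+1 k * cellint n.+1 P i j.
rewrite (_ : \sum_(0 <= i < 2 ^ n.+1) _ =
  eps * \sum_(0 <= k < n.+1) T1 k -
  eps ^+ 2 * \sum_(0 <= k < n.+1) \sum_(0 <= l < k) T2 k l); last first.
  under eq_bigr do under eq_bigr do rewrite im_riesz_head_tail mulrBl.
  under eq_bigr do rewrite sumrB.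
  rewrite sumrB; congr (_ - _).
    under eq_bigr do under eq_bigr do rewrite -mulrA mulr_suml.
    under eq_bigr do rewrite -mulr_sumr exchange_big.
    by rewrite -mulr_sumr exchange_big.
  under eq_bigr do under eq_bigr do rewrite -mulrA mulr_suml.
  under eq_bigr do rewrite -mulr_sumr exchange_big.
  rewrite -mulr_sumr exchange_big; congr (_ * _); apply: eq_bigr => k _ /=.
  under eq_bigr do under eq_bigr do rewrite mulr_suml.
  under eq_bigr do rewrite exchange_big.
  by rewrite exchange_big.
have f1 i j k : `|haar_layer n P i j k| <= 1.
  by rewrite /haar_layer !normrM !normr_rademacher !mulr1 normrN normr_nat lern1 leq_b1.
apply: lerB.
  rewrite -epsn -mulrA ler_pM2l //.
  apply: (@le_trans _ _ (\sum_(0 <= k < n.+1) c)).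
    by rewrite sumr_const_nat subn0 -[leRHS]mulr_natl.
  by rewrite !big_nat; apply: ler_sum => k kn; apply: haar_layer_cellint.
have d0 : 0 <= d.
  by rewrite mulr_ge0 ?mulr_ge0 ?sqrtr_ge0 ?ler0n // invr_ge0 mulr_ge0 ?exprn_ge0.
rewrite eps2 mulrC ler_pdivrMr ?ltr0n // mulrC.
apply: (@le_trans _ _ (\sum_(0 <= k < n.+1) d)); last first.
  by rewrite sumr_const_nat subn0 -[leLHS]mulr_natl.
rewrite !big_nat; apply: ler_sum => k kn.
apply: (@le_trans _ _ (\sum_(0 <= l < k) d * (2 ^+ l / 2 ^+ k))).
  rewrite !big_nat; apply: ler_sum => l lk.
  apply: le_trans (ler_norm _) _; apply: haar_layer_pair_cellint => //; first by lia.
  by move=> i j; apply: im_riesz_bound => //; lia.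
rewrite -mulr_sumr -mulr_suml ler_piMr // ler_pdivrMr ?exprn_gt0 // mul1r.
elim: k {kn} => [|k IH]; first by rewrite big_geq ?expr0.
by rewrite big_nat_recr //= exprS mulr2n mulrDl mul1r lerD2r.
Qed.

(** * Integrals over the cells of the grid *)
Local Open Scope classical_set_scope.
Import numFieldNormedType.Exports.

Lemma measurable_step (R : realType) (p : R) (D : set R) :
  measurable_fun D (fun x : R => (p <= x)%R%:R : R).
Proof.
apply: measurable_funS (@measurableT _ _) (@subsetT _ _) _.
rewrite (_ : (fun x : R => _) = \1_(`[p, +oo[%classic : set R)).
  exact: measurable_indic.
apply/funext => x; rewrite indicE; congr (_%:R); congr nat_of_bool.
by rewrite mem_setE /= in_itv /= andbT.
Qed.

Lemma integral_step (R : realType) (p a b : R) : a < b ->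
  (\int[lebesgue_measure]_(x in `[a, b[) ((p <= x)%R%:R)%:E)%E =
  (hinge p b - hinge p a)%:E.
Proof.
move=> ab.
transitivity (\int[@lebesgue_measure R]_(x in `[a, b[)
    (\1_(`[p, +oo[%classic : set R) x)%:E)%E.
  apply: eq_integral => x _; rewrite indicE; congr (_%:R)%:E; congr nat_of_bool.
  by rewrite mem_setE /= in_itv /= andbT.
rewrite integral_indic //.
have -> : `[p, +oo[ `&` `[a, b[ = `[Num.max p a, b[ :> set R.
  apply/seteqP; split => x /=; rewrite !in_itv /= ge_max andbT.
    by move=> [-> /andP[-> ->]].
  by move=> /andP[/andP[-> ->] ->].
have := lebesgue_measure_itv `[Num.max p a, b[%R => /= ->.
rewrite lte_fin /hinge.
case: ltP => h; rewrite -?EFinB; congr EFin.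
  move: h; rewrite gt_max => /andP[pb _].
  rewrite (max_l (_ : 0 <= b - p)) ?subr_ge0 ?ltW //.
  by case: (leP p a) => pa; [rewrite max_l|rewrite max_r]; lra.
move: h; rewrite le_max leNgt => /orP[|]; last by rewrite leNgt ab.
by move=> bp; rewrite !max_r //; lra.
Qed.

Lemma integral_id (R : realType) (a b : R) : a < b ->
  (\int[lebesgue_measure]_(x in `[a, b[) x%:E)%E = (b ^+ 2 / 2 - a ^+ 2 / 2)%:E.
Proof.
move=> ab; rewrite integral_itv_bndo_bndc; last exact/measurable_EFinP.
rewrite (@continuous_FTC2 _ id (fun x : R => x ^+ 2 / 2)) //.
- by apply: continuous_subspaceT => x; exact: cvg_id.
- have c (x : R) : {for x, continuous (fun x : R => x ^+ 2 / 2)}.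
    by apply/differentiable_continuous.
  split => //.
  + by apply: cvg_at_right_filter; exact: c.
  + by apply: cvg_at_left_filter; exact: c.
- by move=> x _; rewrite derive1E deriveM // derive_cst; rewrite exp_derive /GRing.scale /=; field.
Qed.

Lemma integrable_step (R : realType) (p a b : R) :
  lebesgue_measure.-integrable `[a, b[ (fun x : R => ((p <= x)%R%:R)%:E).
Proof.
apply: measurable_bounded_integrable => //.
- by rewrite /= lebesgue_measure_itv /=; case: ifP => // _; rewrite -EFinB ltry.
- exact: measurable_step.
- exists 1; split => // M M1 x _ /=.
  by apply: le_trans (ltW M1); rewrite normr_nat lern1 leq_b1.
Qed.

Lemma integrable_id (R : realType) (a b : R) :
  lebesgue_measure.-integrable `[a, b[ (fun x : R => x%:E).
Proof.
apply: measurable_bounded_integrable => //.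
- by rewrite /= lebesgue_measure_itv /=; case: ifP => // _; rewrite -EFinB ltry.
- exists (`|a| + `|b|); split => // M M1 x /=; rewrite in_itv /= => /andP[ax xb].
  apply: le_trans (ltW M1); rewrite ler_norml.
  have := ler_norm b; have := lerNnormlW (lexx `|a|); have := normr_ge0 a; have := normr_ge0 b.
  by lra.
Qed.

(** As a function of either variable alone, the discrepancy is a combination of
    indicators of half-lines plus a multiple of the variable; this form serves
    for the inner and for the outer integral. *)
Lemma integral_steps_id (R : realType) (T : Type) (s : seq T) (w q : T -> R)
    (c a b : R) : a < b ->
  lebesgue_measure.-integrable `[a, b[
    (fun x : R => (\sum_(t <- s) w t * (q t <= x)%R%:R + c * x)%:E) /\
  (\int[lebesgue_measure]_(x in `[a, b[)
     (\sum_(t <- s) w t * (q t <= x)%R%:R + c * x)%:E)%E =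
  (\sum_(t <- s) w t * (hinge (q t) b - hinge (q t) a)
    + c * (b ^+ 2 / 2 - a ^+ 2 / 2))%:E.
Proof.
move=> ab; elim: s => [|t s [IH1 IH2]].
  have E : (fun x : R => (\sum_(t <- [::]) w t * (q t <= x)%R%:R + c * x)%:E) =
           (fun x : R => c%:E * x%:E)%E.
    by apply/funext => x; rewrite big_nil add0r EFinM.
  rewrite E; split; first by apply: integrableZl => //; exact: integrable_id.
  by rewrite integralZl ?integral_id ?big_nil ?add0r // ; exact: integrable_id.
have E : (fun x : R => (\sum_(t <- t :: s) w t * (q t <= x)%R%:R + c * x)%:E) =
   ((fun x => (w t)%:E * ((q t <= x)%R%:R)%:E) \+
    (fun x : R => (\sum_(t <- s) w t * (q t <= x)%R%:R + c * x)%:E))%E.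
  by apply/funext => x; rewrite big_cons -EFinM -EFinD addrA.
have I1 : lebesgue_measure.-integrable `[a, b[
   (fun x => (w t)%:E * ((q t <= x)%R%:R)%:E)%E.
  by apply: integrableZl => //; exact: integrable_step.
rewrite E; split; first exact: integrableD.
rewrite integralD // IH2 integralZl //; last exact: integrable_step.
by rewrite integral_step // -EFinM -EFinD big_cons addrA.
Qed.

Lemma sum_integral_grid (R : realType) (K : nat) (f : R -> \bar R) :
  measurable_fun setT f -> (forall x, 0 <= f x)%E ->
  (\sum_(0 <= i < 2 ^ K) \int[lebesgue_measure]_(x in `[grid R K i, grid R K i.+1[) f x
   <= \int[lebesgue_measure]_(x in `[0%R, 1%R]) f x)%E.
Proof.
move=> mf f0.
have mono (i j : nat) : (i <= j)%N -> grid R K i <= grid R K j.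
  by move=> ij; rewrite ler_pM2r ?invr_gt0 ?exprn_gt0 // ler_nat.
have merge m : (\sum_(0 <= i < m)
    \int[lebesgue_measure]_(x in `[grid R K i, grid R K i.+1[) f x =
    \int[lebesgue_measure]_(x in `[0%R, grid R K m[) f x)%E.
  elim: m => [|m IH].
    by rewrite big_geq // /grid mul0r set_itvco0 integral_set0.
  rewrite big_nat_recr //= IH -ge0_integral_setU //.
  - congr integral; apply/esym; apply: itv_bndbnd_setU; rewrite bnd_simp; last exact: mono.
    by apply: le_trans (mono _ _ (leq0n m)); rewrite /grid mul0r.
  - exact: measurable_funS mf.
  - apply/disj_setPS => x [/=]; rewrite !in_itv /= => /andP[_ xl] /andP[lx _].
    by have := lt_le_trans xl lx; rewrite ltxx.
rewrite merge; apply: ge0_subset_integral => //; first exact: measurable_funS mf.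
move=> x /=; rewrite !in_itv /= => /andP[-> /ltW xl] /=; apply: le_trans xl _.
by rewrite /grid natrX divff // expf_neq0.
Qed.

(** The discrepancy function on the whole plane, which makes its joint
    measurability straightforward. *)
Definition disc (R : realType) (s : seq (R * R)) (z : R * R) : R :=
  \sum_(p <- s) (p.1 <= z.1)%R%:R * (p.2 <= z.2)%R%:R - (size s)%:R * (z.1 * z.2).

Lemma discrepancyE (R : realType) (P : {fset R * R}) (x y : R) :
  (forall p, p \in P -> 0 <= p.1 /\ 0 <= p.2) -> discrepancy P x y = disc P (x, y).
Proof.
move=> P0; congr (_ - _).
rewrite card_fset_sum1 natr_sum big_fset /= big_mkcond !big_seq; apply: eq_bigr => p pP.
have [p1 p2] := P0 _ pP.
by rewrite !in_itv /= p1 p2 /=; do 2 case: (_ <= _); rewrite ?mulr0 ?mul0r ?mulr1.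
Qed.

(** Inserting the indicator of B turns the integral over B into one over the
    whole line, to which the Tonelli theorem applies. *)
Lemma measurable_sliced_integral (R : realType) (F : R * R -> \bar R) (B : set R) :
  measurable B -> measurable_fun setT F -> (forall z, 0 <= F z)%E ->
  measurable_fun setT (fun x => \int[lebesgue_measure]_(y in B) F (x, y))%E.
Proof.
move=> mB mF F0.
rewrite (_ : (fun x => _) =
  fubini_F lebesgue_measure (fun z => F z * (\1_B z.2)%:E)%E); last first.
  apply/funext => x; rewrite /fubini_F [LHS]integral_mkcond epatch_indic.
  by apply: eq_integral => y _ /=.
apply: measurable_fun_fubini_tonelli_F.
  apply: emeasurable_funM => //; apply/measurable_EFinP.
  by apply: measurableT_comp measurable_snd; exact: measurable_indic.
by move=> z; rewrite mule_ge0 // lee_fin.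
Qed.

Lemma measurable_disc (R : realType) (s : seq (R * R)) : measurable_fun setT (disc s).
Proof.
have step (p : R) (f : R * R -> R) : measurable_fun setT f ->
    measurable_fun setT (fun z => (p <= f z)%R%:R : R).
  by move=> mf; exact: (measurableT_comp (@measurable_step R p setT) mf).
apply: measurable_funB; last by do !apply: measurable_funM => //.
by apply: measurable_sum => p; apply: measurable_funM => //; apply: step.
Qed.

Lemma measurable_abs_disc (R : realType) (s : seq (R * R)) :
  measurable_fun setT (fun z => `|disc s z|%:E).
Proof.
by apply/measurable_EFinP; apply: measurableT_comp => //; exact: measurable_disc.
Qed.

Lemma measurable_sliced_abs_disc (R : realType) (s : seq (R * R)) (B : set R) :
  measurable B -> measurable_fun setT
   (fun x => \int[lebesgue_measure]_(y in B) `|disc s (x, y)|%:E)%E.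
Proof.
move=> mB; apply: (@measurable_sliced_integral _ (fun z => `|disc s z|%:E)) => //.
exact: measurable_abs_disc.
Qed.

Lemma abs_cellint_le (R : realType) (K : nat) (s : seq (R * R)) (i j : nat) :
  ((`|cellint K s i j|)%:E <=
   \int[lebesgue_measure]_(x in `[grid R K i, grid R K i.+1[)
    \int[lebesgue_measure]_(y in `[grid R K j, grid R K j.+1[)
      `|disc s (x, y)|%:E)%E.
Proof.
have lt_grid h : grid R K h < grid R K h.+1.
  by rewrite ltr_pM2r ?invr_gt0 ?exprn_gt0 // ltr_nat.
pose v (p : R * R) := hinge p.2 (grid R K j.+1) - hinge p.2 (grid R K j).
pose sj := grid R K j.+1 ^+ 2 / 2 - grid R K j ^+ 2 / 2.
pose H (x y : R) := \sum_(p <- s) (p.1 <= x)%R%:R * (p.2 <= y)%R%:R + (- (size s)%:R * x) * y.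
pose h (x : R) := \sum_(p <- s) v p * (p.1 <= x)%R%:R + (- (size s)%:R * sj) * x.
have HE x := integral_steps_id s (fun p => (p.1 <= x)%R%:R) snd (- (size s)%:R * x) (lt_grid j).
have hE := integral_steps_id s v fst (- (size s)%:R * sj) (lt_grid i).
have mh D : measurable_fun D (fun x => h x).
  apply: measurable_funD; last by apply: measurable_funM.
  by apply: measurable_sum => p; apply: measurable_funM => //; exact: measurable_step.
have mH x : measurable_fun setT (fun y => H x y).
  apply: measurable_funD; last by apply: measurable_funM.
  by apply: measurable_sum => p; apply: measurable_funM => //; exact: measurable_step.
have -> : (`|cellint K s i j|%:E =
    `|\int[lebesgue_measure]_(x in `[grid R K i, grid R K i.+1[) (h x)%:E|)%E.
  rewrite (hE.2) abse_EFin /cellint; congr (`|_|)%:E.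
  rewrite -/sj; congr (_ + _); last by ring.
  by apply: eq_bigr => p _; rewrite mulrC.
apply: le_trans (le_abse_integral _ _ _) _ => //; first by apply/measurable_EFinP; exact: mh.
apply: ge0_le_integral => //.
- apply: measurableT_comp; first exact: abse_measurable.
  by apply/measurable_EFinP; exact: mh.
- by apply: (@measurable_funS _ _ _ _ setT) => //; exact: measurable_sliced_abs_disc.
- move=> x _.
  rewrite (_ : (h x)%:E = \int[lebesgue_measure]_(y in `[grid R K j, grid R K j.+1[) (H x y)%:E)%E.
    apply: le_trans (le_abse_integral _ _ _) _ => //.
      by apply/measurable_EFinP; apply: measurable_funS (mH x).
    rewrite le_eqVlt; apply/orP; left; apply/eqP; apply: eq_integral => y _ /=.
    by congr (`|_|)%:E; rewrite /H /disc /=; congr (_ + _); ring.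
  rewrite (HE x).2; congr EFin; rewrite /h -/sj; congr (_ + _); last by ring.
  by apply: eq_bigr => p _; rewrite mulrC.
Qed.

Lemma sum_cellint_le_L1 (R : realType) (K : nat) (P : {fset R * R}) :
  (forall p, p \in P -> 0 <= p.1 /\ 0 <= p.2) ->
  ((\sum_(0 <= i < 2 ^ K) \sum_(0 <= j < 2 ^ K) `|cellint K P i j|)%:E
    <= L1_discrepancy P)%E.
Proof.
move=> P0; rewrite /L1_discrepancy.
under eq_integral do under eq_integral do rewrite discrepancyE //.
have mF (B : set R) := @measurable_sliced_abs_disc R P B.
apply: le_trans (sum_integral_grid K (mF _ (measurable_itv _)) _); last first.
  by move=> x; apply: integral_ge0.
rewrite -sumEFin; apply: lee_sum => i _.
apply: (@le_trans _ _ (\int[lebesgue_measure]_(x in `[grid R K i, grid R K i.+1[)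
  \sum_(0 <= j < 2 ^ K)
  \int[lebesgue_measure]_(y in `[grid R K j, grid R K j.+1[) `|disc P (x, y)|%:E)%E); last first.
  apply: ge0_le_integral => //.
  - by move=> x _; apply: sume_ge0 => j _; apply: integral_ge0.
  - by apply: emeasurable_sum => j; apply: (@measurable_funS _ _ _ _ setT) => //; exact: mF.
  - by apply: (@measurable_funS _ _ _ _ setT) => //; exact: mF.
  - move=> x _; apply: (@sum_integral_grid _ K (fun y => `|disc P (x, y)|%:E)) => //.
    by apply: measurableT_comp (measurable_abs_disc P) _.
rewrite ge0_integral_sum //.
- by rewrite -sumEFin; apply: lee_sum => j _; exact: abs_cellint_le.
- by move=> j; apply: (@measurable_funS _ _ _ _ setT) => //; exact: mF.
- by move=> j x _; apply: integral_ge0.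
Qed.

(** * The lower bound for a single point set *)
Lemma L1_discrepancy_ge (R : realType) (n : nat) (P : {fset R * R}) (t : R) :
  (forall p, p \in P -> 0 <= p.1 /\ 0 <= p.2) ->
  t = #|` P|%fset%:R / 2 ^+ n ->
  ((Num.sqrt n.+1%:R * (t * (1 - t)) / (16 * Num.sqrt (expR 1)) - t / 16)%:E
    <= L1_discrepancy P)%E.
Proof.
move=> P0 tE; apply: le_trans (sum_cellint_le_L1 n.+1 P0); rewrite lee_fin.
have se0 : 0 < Num.sqrt (expR 1 : R) by rewrite sqrtr_gt0 expR_gt0.
rewrite -(ler_pM2l se0).
apply: (@le_trans _ _ (\sum_(0 <= i < 2 ^ n.+1) \sum_(0 <= j < 2 ^ n.+1)
     im_riesz (Num.sqrt n.+1%:R)^-1 (haar_layer n P i j) 0 n.+1 * cellint n.+1 P i j)).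
  apply: le_trans (im_riesz_cellint n P0).
  rewrite le_eqVlt tE; apply/orP; left; apply/eqP.
  by field; rewrite expf_neq0 // gt_eqF.
rewrite mulr_sumr; apply: ler_sum => i _; rewrite mulr_sumr; apply: ler_sum => j _.
apply: le_trans (ler_norm _) _; rewrite normrM; apply: ler_wpM2r => //.
apply: im_riesz_bound => // k.
by rewrite /haar_layer !normrM !normr_rademacher !mulr1 normrN normr_nat lern1 leq_b1.
Qed.

(** The two square roots compare through ln N <= (n + 1) ln 2; the error term
    t / 16 is at most 1. *)
Lemma normalized_L1_discrepancy_ge (R : realType) (n N : nat) (c : R) :
  (1 < N)%N -> (2 * N <= 2 ^ n)%N -> 0 <= c ->
  c <= N%:R / 2 ^+ n * (1 - N%:R / 2 ^+ n) ->
  ((c / (16 * Num.sqrt (expR 1 * ln 2)) - (Num.sqrt (ln N%:R))^-1)%:E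
    <= normalized_L1_discrepancy R N)%E.
Proof.
move=> N1 Nn c0; set t := N%:R / _ => ct.
have p0 : 0 < 2 ^+ n :> R by rewrite exprn_gt0.
have t0 : 0 <= t by rewrite divr_ge0 // ltW.
have t1 : t <= 1.
  by rewrite ler_pdivrMr // mul1r -natrX ler_nat; apply: leq_trans Nn; lia.
have ln2 : 0 < ln 2 :> R by rewrite ln_gt0 // ltr1n.
have lnN : 0 < ln N%:R :> R by rewrite ln_gt0 // ltr1n.
have sl0 : 0 < Num.sqrt (ln N%:R) :> R by rewrite sqrtr_gt0.
have se0 : 0 < Num.sqrt (expR 1 : R) by rewrite sqrtr_gt0 expR_gt0.
have s20 : 0 < Num.sqrt (ln 2 : R) by rewrite sqrtr_gt0.
have lnn : Num.sqrt (ln N%:R) <= Num.sqrt n.+1%:R * Num.sqrt (ln 2) :> R.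
  rewrite -sqrtrM // ler_sqrt ?mulr_ge0 ?(ltW ln2) // mulr_natl -lnXn ?ltr0n //.
  rewrite ler_ln ?posrE ?exprn_gt0 ?ltr0n ?(ltnW N1) // -natrX ler_nat expnS.
  by lia.
rewrite /normalized_L1_discrepancy.
apply: (@le_trans _ _ ((Num.sqrt (ln N%:R))^-1 *
   (Num.sqrt n.+1%:R * (t * (1 - t)) / (16 * Num.sqrt (expR 1)) - t / 16))%:E).
  rewrite lee_fin sqrtrM ?expR_ge0 // mulrBr; apply: lerB.
    rewrite [leRHS]mulrC ler_pdivlMr //.
    apply: (@le_trans _ _ (Num.sqrt n.+1%:R * c / (16 * Num.sqrt (expR 1)))).
      rewrite -(ler_pM2r se0) -(ler_pM2r s20).
      rewrite [leLHS](_ : _ = c / 16 * Num.sqrt (ln N%:R)); last first.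
        by field; rewrite !gt_eqF.
      rewrite [leRHS](_ : _ = c / 16 * (Num.sqrt n.+1%:R * Num.sqrt (ln 2))); last first.
        by field; rewrite gt_eqF.
      by apply: ler_wpM2l => //; rewrite divr_ge0.
    apply: ler_wpM2r; first by rewrite invr_ge0 mulr_ge0 // ltW.
    exact: ler_wpM2l.
  by rewrite ler_piMr ?invr_ge0 ?ltW //; lra.
rewrite EFinM; apply: lee_wpmul2l; first by rewrite lee_fin invr_ge0 ltW.
apply/ereal_infP => _ [P [Psub PN] <-].
apply: L1_discrepancy_ge; last by rewrite PN.
move=> p pP.
by have [/=] := Psub _ pP; rewrite !in_itv /= => /andP[-> _] /andP[-> _].
Qed.

(** * Limits *)
Lemma inv_sqrt_ln_small (R : realType) (e : R) : 0 < e ->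
  exists N0, forall N, (N0 <= N)%N -> (Num.sqrt (ln N%:R : R))^-1 <= e.
Proof.
move=> e0; exists (Num.truncn (expR (e ^- 2))).+1 => N NN.
have x0 : 0 < expR (e ^- 2) by rewrite expR_gt0.
have xN : expR (e ^- 2) < N%:R.
  have /andP[_ h] := truncn_itv (ltW x0).
  by apply: lt_le_trans h _; rewrite ler_nat.
have lnN : e ^- 2 <= ln N%:R.
  by rewrite -[leLHS]expRK ler_ln ?posrE // ?ltW // (lt_trans x0).
rewrite -[e]invrK lef_pV2 ?posrE ?invr_gt0 ?sqrtr_gt0 //; last first.
  by apply: lt_le_trans lnN; rewrite invr_gt0 exprn_gt0.
rewrite -[leLHS]ger0_norm ?invr_ge0 ?(ltW e0) // -sqrtr_sqr exprVn ler_sqrt //.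
by apply: le_trans lnN; rewrite invr_ge0 exprn_ge0 // ltW.
Qed.

Lemma limn_einf_ge (R : realType) (u : (\bar R)^nat) (c : \bar R) (N0 : nat) :
  (forall N, (N0 <= N)%N -> c <= u N)%E -> (c <= limn_einf u)%E.
Proof.
move=> cu; rewrite limn_einf_lim; apply: lime_ge; first exact: is_cvg_einfs.
near=> n; apply/ereal_infP => _ [k /= nk <-]; apply: cu.
by apply: leq_trans nk; near: n; exact: nbhs_infty_ge.
Unshelve. all: by end_near.
Qed.

Lemma limn_esup_ge (R : realType) (u : (\bar R)^nat) (c : \bar R) :
  (forall n, exists2 N, (n <= N)%N & c <= u N)%E -> (c <= limn_esup u)%E.
Proof.
move=> cu; rewrite limn_esup_lim; apply: lime_ge; first exact: is_cvg_esups.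
near=> n; have [N nN cN] := cu n; apply: le_trans cN _.
by apply: ereal_sup_ubound; exists N.
Unshelve. all: by end_near.
Qed.

Theorem theorem1p4 (R : realType) :
  ((3 / (256 * Num.sqrt (expR 1 * ln 2)))%:E <= limn_einf (@normalized_L1_discrepancy R))%E /\
  ((1 / (64 * Num.sqrt (expR 1 * ln 2)))%:E <= limn_esup (@normalized_L1_discrepancy R))%E.
Proof.
have C0 : Num.sqrt (expR 1 * ln 2) != 0 :> R.
  by rewrite gt_eqF // sqrtr_gt0 mulr_gt0 ?expR_gt0 // ln_gt0 // ltr1n.
split; apply/lee_subgt0Pr => e e0; have [N0 N0P] := inv_sqrt_ln_small e0.
  (* the exponent trunc_log 2 N + 2 puts t in [1/4, 1/2] *)
  apply: (@limn_einf_ge _ _ _ (maxn N0 2)) => N; rewrite geq_max => /andP[NN N1].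
  have /andP[lN uN] : (2 ^ trunc_log 2 N <= N < 2 ^ (trunc_log 2 N).+1)%N.
    by apply: trunc_log_bounds => //; apply: ltnW.
  apply: le_trans (@normalized_L1_discrepancy_ge R (trunc_log 2 N).+2 N (3 / 16) N1 _ _ _).
  - rewrite -EFinB lee_fin; apply: lerB; last exact: N0P.
    by rewrite le_eqVlt; apply/orP; left; apply/eqP; field.
  - by rewrite expnS leq_mul2l (ltnW uN) orbT.
  - by rewrite divr_ge0.
  - set t := N%:R / _.
    have p0 : 0 < 2 ^+ (trunc_log 2 N) :> R by rewrite exprn_gt0.
    have tl : 1 / 4 <= t.
      rewrite /t !exprS mulrA ler_pdivlMr; last by rewrite !mulr_gt0.
      by move: lN; rewrite -(ler_nat R) natrX; lra.
    have tu : t <= 1 / 2.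
      rewrite /t !exprS mulrA ler_pdivrMr; last by rewrite !mulr_gt0.
      by move: (ltnW uN); rewrite -(ler_nat R) natrX exprS; lra.
    nra.
(* along powers of 2, with the exponent increased by one, t = 1/2 *)
apply: limn_esup_ge => n; pose N := (2 ^ (maxn N0 n).+1)%N.
have mN : (maxn N0 n < N)%N 
  by apply: (@leq_trans (2 ^ maxn N0 n)); [exact: ltn_expl | rewrite leq_exp2l].
exists N; first by apply: leq_trans (ltnW mN); rewrite leq_maxr.
apply: le_trans (@normalized_L1_discrepancy_ge R (maxn N0 n).+2 N (1 / 4) _ _ _ _).
- rewrite -EFinB lee_fin; apply: lerB; last first.
    by apply: N0P; apply: leq_trans (ltnW mN); rewrite leq_maxl.
  by rewrite le_eqVlt; apply/orP; left; apply/eqP; field.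
- by rewrite (@leq_exp2l 2 1 (maxn N0 n).+1).
- by rewrite [leqRHS]expnS.
- by rewrite divr_ge0.
- have -> : N%:R / 2 ^+ (maxn N0 n).+2 = 1 / 2 :> R.
    by rewrite /N natrX [in X in _ / X]exprS; field; rewrite expf_neq0.
  lra.
Qed.
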